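(* Let $V=V_{-1}\oplus V_0\oplus V_1$ with $V_{-1}=\langle u\rangle$, $V_0=\langle v\rangle$, $V_1=\langle w\rangle$ one-dimensional, equipped with the skew symmetric linear operators $l_n:V^{\otimes n}\to V$ of degree $2-n$ ($n\ge1$) given by constants $a_n,b_n,c_n$ via $$l_n(u\otimes v\otimes w^{\otimes n-2})=a_n u\ (n\ge2),\qquad l_n(u\otimes w^{\otimes n-1})=b_n v\ (n\ge1),\qquad l_n(v\otimes w^{\otimes n-1})=c_n w\ (n\ge1).$$ Suppose that $V$ with these operators is an $L_3$ structure. Then this structure is a differential graded Lie algebra.
   Context: All vector spaces are graded, over a fixed field of characteristic zero; $|x|$ is the degree of $x$. For a permutation $\sigma$ of a string of homogeneous elements, $\varepsilon(\sigma)$ is the Koszul sign (a factor $(-1)^{pq}$ whenever elements of degrees $p$ and $q$ are commuted) and $\chi(\sigma)=(-1)^{\sigma}\varepsilon(\sigma)$, where $(-1)^\sigma$ is the sign of $\sigma$. A $(p,n-p)$ unshuffle is $\sigma\in S_n$ with $\sigma(1)<\dots<\sigma(p)$ and $\sigma(p+1)<\dots<\sigma(n)$. A linear map $l:V^{\otimes n}\to V$ has degree $k$ if $l(x_1\otimes\dots\otimes x_n)\in V_N$ with $N=k+\sum|x_i|$; it is skew symmetric if $l(x_{\pi(1)}\otimes\dots\otimes x_{\pi(n)})=\chi(\pi)\,l(x_1\otimes\dots\otimes x_n)$ for all $\pi\in S_n$. Given skew symmetric maps $l_k$, define $\mathcal J_n:V^{\otimes n}\to V$ by $$\mathcal J_n(x_1\otimes\dots\otimes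 x_n)=\sum_{p=1}^n(-1)^{p(n-p)}\sum_{\sigma\ (p,n-p)\text{ unshuffle}}\chi(\sigma)\,l_{n-p+1}\big(l_p(x_{\sigma(1)}\otimes\dots\otimes x_{\sigma(p)})\otimes x_{\sigma(p+1)}\otimes\dots\otimes x_{\sigma(n)}\big).$$ $V$ is $L_m$ (an $L_m$ structure) if the maps $l_k$, $1\le k\le m$, are skew symmetric, linear, of degree $2-k$, and $\mathcal J_n=0$ for all $1\le n\le m$. A differential graded Lie algebra is an $L_2$ structure $(V,l_1,l_2)$ which satisfies $\sum_{\sigma\ (2,1)\text{ unshuffle}}\chi(\sigma)\,l_2(l_2(x_{\sigma(1)}\otimes x_{\sigma(2)})\otimes x_{\sigma(3)})=0$ for all $x_1,x_2,x_3$ (no condition is imposed on the higher operators $l_n$, $n\geq 3$). In the claim, $u,v,w$ have degrees $-1,0,1$, and all other graded components of $V$ are zero. The values of $l_n$ on permutations of the listed tensors are determined by skew symmetry; $l_n$ vanishes on all other tensors of basis vectors. *)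

(* Defs.v *)
From HB Require Import structures.
From mathcomp Require Import all_boot all_order all_algebra all_fingroup.

Set Implicit Arguments.
Unset Strict Implicit.
Unset Printing Implicit Defensive.

Import GRing.Theory.

Local Open Scope ring_scope.

(* A Z-grading of V: V is the internal direct sum of the submodules gr i. *)
Record grading (K : fieldType) (V : lmodType K) := Grading {
  gr :> int -> submodClosed V;
  gr_span : forall x : V, exists (s : seq int) (f : int -> V),
    (forall i, f i \in gr i) /\ x = \sum_(i <- s) f i;
  gr_direct : forall (s : seq int) (f : int -> V), uniq s ->
    (forall i, f i \in gr i) -> \sum_(i <- s) f i = 0 ->
    forall i, i \in s -> f i = 0
}.

Section GradedOperators.

Variables (K : fieldType) (V : lmodType K) (G : grading V).

Definition homogeneous n (d : 'I_n -> int) (x : {ffun 'I_n -> V}) : Prop :=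
  forall i, x i \in G (d i).

(* The Koszul sign of x_0 ... x_(n-1) |-> x_(s 0) ... x_(s (n-1)), where x_i *)
(* has degree d i: the pairs that get commuted are the inversions of s.      *)
Definition koszul n (d : 'I_n -> int) (s : 'S_n) : K :=
  \prod_(i < n) \prod_(j < n | (i < j)%N && (s j < s i)%N)
    (-1) ^ (d (s i) * d (s j)).

Definition chi n (d : 'I_n -> int) (s : 'S_n) : K := (-1) ^+ s * koszul d s.

(* Indices start at 0, so the first block is {0, ..., p - 1}. *)
Definition unshuffle n (p : nat) (s : 'S_n) : bool :=
  [forall i : 'I_n, forall j : 'I_n,
     (i < j)%N && ((j < p)%N || (p <= i)%N) ==> (s i < s j)%N].

(* Linear maps from the n-th tensor power of V are represented by            *)
(* multilinear maps of n arguments.                                          *)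
Definition set_arg n (x : {ffun 'I_n -> V}) (i : 'I_n) (y : V) :
  {ffun 'I_n -> V} := [ffun j => if j == i then y else x j].

Definition multilinear n (f : {ffun 'I_n -> V} -> V) : Prop :=
  forall x i (k : K) (y z : V),
    f (set_arg x i (k *: y + z)) = k *: f (set_arg x i y) + f (set_arg x i z).

Definition has_degree n (k : int) (f : {ffun 'I_n -> V} -> V) : Prop :=
  forall d x, homogeneous d x -> f x \in G (k + \sum_(i < n) d i).

Definition skew_symmetric n (f : {ffun 'I_n -> V} -> V) : Prop :=
  forall d x (s : 'S_n), homogeneous d x ->
    f [ffun i => x (s i)] = chi d s *: f x.

(* l 0 is part of the type of l but is never used below. *)
Variable l : forall n : nat, {ffun 'I_n -> V} -> V.

Definition cons_arg n (y : V) (x : {ffun 'I_n -> V}) : {ffun 'I_n.+1 -> V} :=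
  [ffun i => oapp x y (unlift ord0 i)].

Definition first_args n p (le_pn : (p <= n)%N) (x : {ffun 'I_n -> V}) :
  {ffun 'I_p -> V} := [ffun i => x (widen_ord le_pn i)].

Definition last_args n p (le_pn : (p <= n)%N) (x : {ffun 'I_n -> V}) :
  {ffun 'I_(n - p) -> V} :=
  [ffun i => x (cast_ord (subnKC le_pn) (rshift p i))].

Definition unshuffle_sum n p (le_pn : (p <= n)%N) (d : 'I_n -> int)
    (x : {ffun 'I_n -> V}) : V :=
  \sum_(s : 'S_n | unshuffle p s)
    let y := [ffun i => x (s i)] in
    chi d s *: l (cons_arg (l (first_args le_pn y)) (last_args le_pn y)).

(* The value of J_n on x, for x homogeneous with degrees d. *)
Definition jacobiator n (d : 'I_n -> int) (x : {ffun 'I_n -> V}) : V :=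
  \sum_(p < n.+1 | (0 < p)%N)
    (-1) ^+ (p * (n - p)) *: unshuffle_sum (leq_ord p) d x.

(* By multilinearity, J_n = 0 iff it vanishes on homogeneous arguments. *)
Definition jacobiator_vanishes (n : nat) : Prop :=
  forall d (x : {ffun 'I_n -> V}), homogeneous d x -> jacobiator d x = 0.

Definition graded_operator (n : nat) : Prop :=
  [/\ multilinear (@l n), skew_symmetric (@l n) & has_degree (2 - n%:Z) (@l n)].

Definition L_structure (m : nat) : Prop :=
  (forall k, (1 <= k <= m)%N -> graded_operator k) /\
  (forall n, (1 <= n <= m)%N -> jacobiator_vanishes n).

Definition dg_Lie_algebra : Prop :=
  L_structure 2 /\
  (forall d (x : {ffun 'I_3 -> V}), homogeneous d x ->
     unshuffle_sum (isT : (2 <= 3)%N) d x = 0).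

Definition is_line (S : {pred V}) (e : V) : Prop :=
  e != 0 /\ forall x, x \in S <-> exists k : K, x = k *: e.

Definition graded_basis (u v w : V) : Prop :=
  [/\ is_line (G (-1)) u, is_line (G 0) v, is_line (G 1) w &
      forall i : int, i \notin [:: -1; 0; 1] -> forall x, x \in G i -> x = 0].

(* The arguments listed in t, followed by copies of w. *)
Definition pad_args (w : V) (t : seq V) n : {ffun 'I_n -> V} :=
  [ffun i : 'I_n => nth w t i].

Definition given_by (u v w : V) (a b c : nat -> K) : Prop :=
  [/\ forall n, (2 <= n)%N -> l (pad_args w [:: u; v] n) = a n *: u,
      forall n, (1 <= n)%N -> l (pad_args w [:: u] n) = b n *: v,
      forall n, (1 <= n)%N -> l (pad_args w [:: v] n) = c n *: w &
      forall n (x : {ffun 'I_n -> V}), (1 <= n)%N ->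
        (forall i, x i \in [:: u; v; w]) ->
        ~~ perm_eq (codom x) (codom (pad_args w [:: u; v] n)) ->
        ~~ perm_eq (codom x) (codom (pad_args w [:: u] n)) ->
        ~~ perm_eq (codom x) (codom (pad_args w [:: v] n)) ->
        l x = 0].

End GradedOperators.

(* Main.v *)
Require Import Defs.
From HB Require Import structures.
From mathcomp Require Import all_boot all_order all_algebra all_fingroup.

Set Implicit Arguments.
Unset Strict Implicit.
Unset Printing Implicit Defensive.

Import GRing.Theory.

Local Open Scope ring_scope.

(** The theorem holds because the constants of l_1 and l_2 that could
    obstruct the Jacobi identity are tied together by the Leibniz rule J_2 = 0.
    Write [y, z] for l_2 and d for l_1, so that
      d u = b_1 v,  d v = c_1 w,  d w = 0,
      [u, v] = a_2 u,  [u, w] = b_2 v,  [v, w] = c_2 w.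
    All other brackets of basis vectors vanish, for degree reasons or, in the
    case of [v, v], by skew symmetry. Evaluating J_2 at (u, u), (u, w) and
    (u, v) gives
      b_1 a_2 = 0,  b_1 c_2 = c_1 b_2,  a_2 b_1 + c_1 b_2 = 0,
    the first because 2 is invertible ([leibniz_constants]). There are three cases.

    - If b_2 = 0, the bracket is that of the one-dimensional Lie algebra V_0
      acting on the abelian ideal spanned by u and w. The Jacobi identity then
      holds whatever a_2 and c_2 are, because two elements of V_0 act by
      commuting operators ([jacobi_b2_eq0]).
    - If b_2 is nonzero then c_1 = 0. If moreover b_1 = 0 then d = 0, the terms
      of J_3 that contain l_3 all disappear, and J_3 = 0 is the Jacobi identity
      ([jacobi_of_diff0]).
    - If b_2 and b_1 are nonzero then a_2 = c_2 = 0. Every bracket is then a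
      multiple of v, and v brackets to zero with everything
      ([double_bracket_eq0]).

    Turning J_2 and the Jacobi sum into formulas in d and the bracket needs the
    unshuffles: an (n, 1) unshuffle of n + 1 letters is determined by the letter
    x_k that it puts last, and the Koszul sign of such an unshuffle is the
    cost of moving x_k past the letters that follow it ([unshuffle_last],
    [koszul_lift_perm]). *)

(** * Unshuffles that put one letter last, and their signs *)

(** Both maps list the same set of letters in increasing order. *)
Lemma increasing_same_image m n (f g : 'I_m -> 'I_n) :
  {homo f : i j / (i < j)%N} -> {homo g : i j / (i < j)%N} ->
  codom f =i codom g -> f =1 g.
Proof.
move=> f_incr g_incr eq_im.
have sorted_codom (h : 'I_m -> 'I_n) :
  {homo h : i j / (i < j)%N} -> sorted (fun i j : 'I_n => (i < j)%N) (codom h).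
  move=> h_incr; rewrite /codom /image_mem sorted_map.
  apply: (sub_sorted (e := relpre val ltn)) => [i j /h_incr // |].
  by have := iota_ltn_sorted 0 m; rewrite -val_enum_ord sorted_map.
have eq_codom : codom f = codom g.
  apply: (@irr_sorted_eq _ (fun i j : 'I_n => (i < j)%N)) => //.
  - by move=> i j k; exact: ltn_trans.
  - by move=> i; exact: ltnn.
  - exact: sorted_codom.
  - exact: sorted_codom.
rewrite !codomE in eq_codom.
by move=> i; have /eq_in_map/(_ i) := eq_codom; apply; rewrite mem_enum.
Qed.

Lemma ltn_lift n (k : 'I_n) (i j : 'I_n.-1) :
  (lift k i < lift k j)%N = (i < j)%N.
Proof. by rewrite !ltnNge leq_bump2. Qed.

Lemma unshuffle_full n (s : 'S_n) : unshuffle n s = (s == 1%g).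
Proof.
apply/idP/eqP => [/forallP s_incr | ->]; last first.
  by apply/forallP=> i; apply/forallP=> j; rewrite !perm1; apply/implyP=> /andP[].
apply/permP=> i; rewrite perm1.
apply: (@increasing_same_image n n s id) i => [i j lt_ij | // | i].
  by have /forallP/(_ j)/implyP := s_incr i; apply; rewrite lt_ij ltn_ord.
by rewrite -{1}(permKV s i) codom_f -[i]/(id i) codom_f.
Qed.

(** Away from the last position, such an unshuffle lists increasingly the letters
    other than k := s ord_max, and so does [lift k]. *)
Lemma unshuffle_last n (s : 'S_n.+1) :
  unshuffle n s = (s == lift_perm ord_max (s ord_max) 1%g).
Proof.
set k := s ord_max; apply/idP/eqP => [/forallP s_incr | ->].
  have s_lift : (fun i => s (lift ord_max i)) =1 lift k.
    apply: increasing_same_image => [i j lt_ij | i j lt_ij | i].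
    - have /forallP/(_ (lift ord_max j))/implyP := s_incr (lift ord_max i).
      by apply; rewrite !lift_max lt_ij ltn_ord.
    - by rewrite ltn_lift.
    - apply/codomP/codomP=> [[j ->] | [j ->]].
        case: (unliftP k (s (lift ord_max j))) => [j' -> | eq_k]; first by exists j'.
        by have /perm_inj/eqP := eq_k; rewrite eq_sym (negPf (neq_lift _ _)).
      case: (unliftP ord_max (s^-1 (lift k j))%g) => [j' eq_j | eq_j].
        by exists j'; rewrite -eq_j permKV.
      by have := neq_lift k j; rewrite -(permKV s (lift k j)) eq_j eqxx.
  apply/permP=> i; case: (unliftP ord_max i) => [j -> | ->].
    by rewrite lift_perm_lift perm1 s_lift.
  by rewrite lift_perm_id.
apply/forallP=> i; apply/forallP=> j; apply/implyP=> /andP[lt_ij].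
have -> : (n <= i)%N = false by apply: contraTF lt_ij => ?; rewrite -leqNgt (leq_trans (leq_ord j)).
rewrite orbF.
case: (unliftP ord_max j) lt_ij => [j' -> | -> ]; last by rewrite ltnn.
case: (unliftP ord_max i) => [i' -> | -> ]; last by rewrite ltnNge leq_ord.
by rewrite !lift_perm_lift !perm1 !lift_max ltn_lift.
Qed.

Section Signs.

Variables (K : fieldType).

(** The inversions are the pairs formed by the last position and a position that
    holds one of the letters after k. *)
Lemma koszul_lift_perm n (d : 'I_n.+1 -> int) (k : 'I_n.+1) :
  koszul K d (lift_perm ord_max k 1%g) =
  \prod_(i < n | (k <= i)%N) (-1) ^ (d (lift k i) * d k).
Proof.
have widenE (i : 'I_n) : widen_ord (leqnSn n) i = lift ord_max i.
  exact/val_inj/esym/lift_max.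
rewrite /koszul big_ord_recr /= [X in _ * X]big_pred0 ?mulr1; last first.
  by move=> j; rewrite ltnNge leq_ord.
rewrite [RHS]big_mkcond; apply: eq_bigr => i _.
rewrite big_mkcond big_ord_recr /= big1 ?mul1r => [|j _]; last first.
  by rewrite !widenE !lift_perm_lift !perm1 ltn_lift; case: ltngtP.
rewrite widenE lift_perm_id lift_perm_lift perm1 ltn_ord /= /bump.
by case: (leqP k i) => [le_ki | /ltnW]; rewrite ?add1n ?ltnS ?le_ki // ltnNge => ->.
Qed.

Lemma chi_lift_perm n (d : 'I_n.+1 -> int) (k : 'I_n.+1) :
  chi K d (lift_perm ord_max k 1%g) =
  (-1) ^+ (n + k) * \prod_(i < n | (k <= i)%N) (-1) ^ (d (lift k i) * d k).
Proof.
by rewrite /chi koszul_lift_perm odd_lift_perm odd_perm1 addbF /= -oddD signr_odd.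
Qed.

Lemma chi1 n (d : 'I_n -> int) : chi K d 1%g = 1.
Proof.
rewrite /chi odd_perm1 mul1r /koszul big1 // => i _; rewrite big_pred0 // => j.
by rewrite !perm1; case: ltngtP.
Qed.

End Signs.

(** * The Jacobi sum and J_2 in terms of l_1 and l_2 *)

Section LowArity.

Variables (K : fieldType) (V : lmodType K) (G : grading V).
Variable l : forall n : nat, {ffun 'I_n -> V} -> V.

Definition diff (y : V) : V := @l 1 [ffun=> y].

Definition bracket (y z : V) : V := @l 2 (pad_args z [:: y] 2).

Let mid : 'I_3 := lift ord0 ord0.

Lemma multilinearZ n (f : {ffun 'I_n -> V} -> V) (x : {ffun 'I_n -> V}) i k y :
  multilinear f -> f (set_arg x i (k *: y)) = k *: f (set_arg x i y).
Proof.
move=> f_lin.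
have f0 : f (set_arg x i 0) = 0.
  by have := f_lin x i (-1) 0 0; rewrite scaler0 addr0 scaleN1r addNr.
by have := f_lin x i k y 0; rewrite f0 !addr0.
Qed.

Lemma multilinear0 n (f : {ffun 'I_n -> V} -> V) (x : {ffun 'I_n -> V}) i :
  multilinear f -> x i = 0 -> f x = 0.
Proof.
move=> f_lin xi0; have := multilinearZ x i 0 0 f_lin; rewrite !scale0r => <-.
by congr f; apply/ffunP=> j; rewrite ffunE; case: eqP => // ->.
Qed.

Lemma big_unshuffle_last n (F : 'S_n.+1 -> V) :
  \sum_(s : 'S_n.+1 | unshuffle n s) F s =
  \sum_(k < n.+1) F (lift_perm ord_max k 1%g).
Proof.
rewrite (reindex_onto (fun k : 'I_n.+1 => lift_perm ord_max k 1%g)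
  (fun s : 'S_n.+1 => s ord_max)) => [|s]; last by rewrite unshuffle_last => /eqP <-.
by apply: eq_bigl => k; rewrite unshuffle_last lift_perm_id !eqxx.
Qed.

Lemma jacobi_sumE (le23 : (2 <= 3)%N) (d : 'I_3 -> int) (x : {ffun 'I_3 -> V}) :
  unshuffle_sum l le23 d x =
    bracket (bracket (x ord0) (x mid)) (x ord_max)
    - (-1) ^ (d ord_max * d mid)
        *: bracket (bracket (x ord0) (x ord_max)) (x mid)
    + ((-1) ^ (d mid * d ord0) * (-1) ^ (d ord_max * d ord0))
        *: bracket (bracket (x mid) (x ord_max)) (x ord0).
Proof.
have term k : 
    l (cons_arg (l (first_args le23 [ffun i => x (lift_perm ord_max k 1%g i)]))
         (last_args le23 [ffun i => x (lift_perm ord_max k 1%g i)])) =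
    bracket (bracket (x (lift k ord0)) (x (lift k ord_max))) (x k).
  rewrite /bracket.
  have -> : first_args le23 [ffun i => x (lift_perm ord_max k 1%g i)] =
      pad_args (x (lift k ord_max)) [:: x (lift k ord0)] 2.
    apply/ffunP=> i; rewrite !ffunE.
    have -> : widen_ord le23 i = lift ord_max i.
      exact/val_inj/esym/lift_max.
    rewrite lift_perm_lift perm1.
    by case: i => [[|[|//]] i_lt] /=; congr (x (lift k _)); apply: val_inj.
  congr (@l 2 _); apply/ffunP=> i; rewrite !ffunE.
  case: (unliftP ord0 i) => [j -> | -> //].
  rewrite ord1 /= /last_args !ffunE.
  have -> : cast_ord (subnKC le23) (rshift 2 ord0) = ord_max by apply: val_inj.
  by rewrite lift_perm_id.
rewrite /unshuffle_sum big_unshuffle_last.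
under eq_bigr => k _ do rewrite term chi_lift_perm.
have [] : [/\ lift ord0 (ord0 : 'I_2) = mid, lift ord0 (ord_max : 'I_2) = ord_max :> 'I_3,
  lift mid ord0 = ord0, lift mid ord_max = ord_max & lift ord_max (ord_max : 'I_2) = mid].
  by split; apply: val_inj.
have liftm0 : lift ord_max (ord0 : 'I_2) = ord0 :> 'I_3 by apply: val_inj.
have last2 : lift ord0 (ord0 : 'I_1) = ord_max :> 'I_2 by apply: val_inj.
move=> l00 l0m l10 l1m lmm.
rewrite big_ord_recl big_ord_recl big_ord1.
rewrite last2 l00 l0m l10 l1m lmm liftm0.
rewrite [X in _ * X *: _ + (_ + _)]big_mkcond.
rewrite [X in _ + (_ * X *: _ + _)]big_mkcond.
rewrite [X in _ + (_ + _ * X *: _)]big_mkcond.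
rewrite !big_ord_recl !big_ord0 /= last2 l00 l0m l1m !mulr1 !mul1r.
rewrite -!(signr_odd _ (_ + _)) /= expr0 expr1 !mul1r mulN1r scale1r scaleNr.
by rewrite addrA addrC -addrA [_ *: _ - _]addrC.
Qed.

Lemma jacobiator2E (d : 'I_2 -> int) (x : {ffun 'I_2 -> V}) :
  jacobiator l d x =
    diff (bracket (x ord0) (x ord_max))
    - (bracket (diff (x ord0)) (x ord_max)
       - (-1) ^ (d ord_max * d ord0) *: bracket (diff (x ord_max)) (x ord0)).
Proof.
have l0 : lift ord0 (ord0 : 'I_1) = ord_max by apply: val_inj.
have l1 : lift ord_max (ord0 : 'I_1) = ord0 by apply: val_inj.
have sum1 (le12 : (1 <= 2)%N) : unshuffle_sum l le12 d x =
    bracket (diff (x ord0)) (x ord_max)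
    - (-1) ^ (d ord_max * d ord0) *: bracket (diff (x ord_max)) (x ord0).
  have term k :
      l (cons_arg (l (first_args le12 [ffun i => x (lift_perm ord_max k 1%g i)]))
           (last_args le12 [ffun i => x (lift_perm ord_max k 1%g i)])) =
      bracket (diff (x (lift k ord0))) (x k).
    rewrite /bracket.
    have -> : first_args le12 [ffun i => x (lift_perm ord_max k 1%g i)] =
        [ffun=> x (lift k ord0)].
      apply/ffunP=> i; rewrite !ffunE ord1.
      have -> : widen_ord le12 ord0 = lift ord_max ord0 by apply: val_inj.
      by rewrite lift_perm_lift perm1.
    congr (@l 2 _); apply/ffunP=> i; rewrite !ffunE.
    case: (unliftP ord0 i) => [j -> | -> //].
    rewrite [j]ord1 /= /last_args !ffunE.
    have -> : cast_ord (subnKC le12) (rshift 1 ord0) = ord_max.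
      exact: val_inj.
    by rewrite lift_perm_id.
  rewrite /unshuffle_sum big_unshuffle_last.
  under eq_bigr => k _ do rewrite term chi_lift_perm.
  rewrite big_ord_recl [X in _ + X]big_ord1 l0 l1.
  rewrite [X in _ * X *: _ + _]big_mkcond [X in _ + _ * X *: _]big_mkcond.
  rewrite !big_ord_recl !big_ord0 /= l0 !mulr1.
  rewrite -!(signr_odd _ (_ + _)) /= expr0 expr1 mulN1r scale1r scaleNr.
  by rewrite addrC.
have sum2 (le22 : (2 <= 2)%N) : unshuffle_sum l le22 d x =
    diff (bracket (x ord0) (x ord_max)).
  rewrite /unshuffle_sum (big_pred1 1%g) => [|s]; last exact: unshuffle_full.
  rewrite chi1 scale1r /diff /bracket.
  have -> : first_args le22 [ffun i => x ((1 : 'S_2) i)%g] =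
      pad_args (x ord_max) [:: x ord0] 2.
    apply/ffunP=> i; rewrite !ffunE perm1.
    by case: i => [[|[|//]] i_lt] /=; congr (x _); apply: val_inj.
  congr (@l 1 _); apply/ffunP=> i; rewrite /cons_arg !ffunE.
  by rewrite [i]ord1 unlift_none.
rewrite /jacobiator big_mkcond !big_ord_recl big_ord0 /= add0r addr0.
by rewrite sum1 sum2 scaleN1r expr0 scale1r addrC.
Qed.

Hypotheses (op1 : graded_operator G l 1) (op2 : graded_operator G l 2).

Lemma diffZ k y : diff (k *: y) = k *: diff y.
Proof.
have [lin1 _ _] := op1; have := multilinearZ [ffun=> 0] ord0 k y lin1.
have E t : set_arg [ffun=> 0] ord0 t = [ffun=> t] :> {ffun 'I_1 -> V}.
  by apply/ffunP=> i; rewrite !ffunE ord1.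
by rewrite !E.
Qed.

Lemma bracketZl z k y : bracket (k *: y) z = k *: bracket y z.
Proof.
have [lin2 _ _] := op2; have := multilinearZ [ffun=> z] ord0 k y lin2.
have E t : set_arg [ffun=> z] ord0 t = pad_args z [:: t] 2.
  by apply/ffunP=> i; rewrite !ffunE; case: i => [[|[|//]]].
by rewrite !E.
Qed.

Lemma bracketZr y k z : bracket y (k *: z) = k *: bracket y z.
Proof.
have [lin2 _ _] := op2; have := multilinearZ [ffun=> y] ord_max k z lin2.
have E t : set_arg [ffun=> y] ord_max t = pad_args t [:: y] 2.
  by apply/ffunP=> i; rewrite !ffunE; case: i => [[|[|//]]].
by rewrite !E.
Qed.

Lemma diff0 : diff 0 = 0.
Proof. by have := diffZ 0 0; rewrite !scale0r. Qed.

Lemma bracket0l z : bracket 0 z = 0.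
Proof. by have := bracketZl z 0 0; rewrite !scale0r. Qed.

Lemma bracket0r y : bracket y 0 = 0.
Proof. by have := bracketZr y 0 0; rewrite !scale0r. Qed.

Lemma diff_degree i y : y \in G i -> diff y \in G (1 + i).
Proof.
move=> Gy; have [_ _ deg1] := op1.
have := deg1 (fun=> i) [ffun=> y]; rewrite big_ord1; apply=> j.
by rewrite ffunE.
Qed.

Lemma bracket_degree i j y z :
  y \in G i -> z \in G j -> bracket y z \in G (i + j).
Proof.
move=> Gy Gz; have [_ _ deg2] := op2.
have := deg2 (fun k => nth j [:: i] k) (pad_args z [:: y] 2).
rewrite big_ord_recl big_ord1 subrr add0r; apply=> k.
by rewrite ffunE; case: k => [[|[|//]]].
Qed.

Lemma bracket_skew i j y z : y \in G i -> z \in G j ->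
  bracket z y = - (-1) ^ (j * i) *: bracket y z.
Proof.
move=> Gy Gz; have [_ skew2 _] := op2.
have := skew2 (fun k => nth j [:: i] k) (pad_args z [:: y] 2)
  (lift_perm ord_max ord0 1%g).
have -> : [ffun k => pad_args z [:: y] 2 (lift_perm ord_max ord0 1%g k)] =
    pad_args y [:: z] 2.
  apply/ffunP=> k; rewrite !ffunE.
  case: (unliftP ord_max k) => [m -> | ->].
    by rewrite lift_perm_lift perm1 lift_max ord1.
  by rewrite lift_perm_id.
rewrite chi_lift_perm big_mkcond big_ord1 /= mulN1r; apply=> k.
by rewrite ffunE; case: k => [[|[|//]]].
Qed.

Lemma leibniz i j y z : jacobiator_vanishes G l 2 -> y \in G i -> z \in G j ->
  diff (bracket y z) =
  bracket (diff y) z - (-1) ^ (j * i) *: bracket (diff z) y.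
Proof.
move=> J2 Gy Gz.
have := J2 (fun k => nth j [:: i] k) (pad_args z [:: y] 2).
rewrite jacobiator2E !ffunE /= => eqJ; apply/eqP; rewrite -subr_eq0; apply/eqP.
by apply: eqJ => k; rewrite ffunE; case: k => [[|[|//]]].
Qed.

(** Every term of J_3 other than those of the Jacobi sum applies l_1, either to
    an argument or to a value of l_3. *)
Lemma jacobi_of_diff0 (le23 : (2 <= 3)%N) d (x : {ffun 'I_3 -> V}) :
  graded_operator G l 3 -> (forall i y, y \in G i -> diff y = 0) ->
  homogeneous G d x -> jacobiator l d x = unshuffle_sum l le23 d x.
Proof.
move=> [lin3 _ deg3] diff_0 Gx.
have sum1 (le13 : (1 <= 3)%N) : unshuffle_sum l le13 d x = 0.
  apply: big1 => s _ /=.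
  rewrite (multilinear0 (i := ord0) lin3) ?scaler0 // ffunE unlift_none /=.
  rewrite -(diff_0 (d (s ord0)) (x (s ord0)) (Gx _)); congr (@l 1 _).
  by apply/ffunP=> i; rewrite !ffunE ord1; congr (x (s _)); apply: val_inj.
have sum3 (le33 : (3 <= 3)%N) : unshuffle_sum l le33 d x = 0.
  apply: big1 => s _ /=; set y := @l 3 _.
  have Gy : y \in G (2 - 3%:Z + \sum_(i < 3) d (s (widen_ord le33 i))).
    by apply: deg3 => i; rewrite !ffunE.
  have -> : cons_arg y (last_args le33 [ffun i => x (s i)]) = [ffun=> y].
    by apply/ffunP=> i; rewrite /cons_arg !ffunE [i]ord1 unlift_none.
  by rewrite -/(diff y) (diff_0 _ _ Gy) scaler0.
rewrite /jacobiator big_mkcond !big_ord_recl big_ord0 /= add0r addr0.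
rewrite sum1 sum3 !scaler0 add0r addr0 -signr_odd /= scale1r.
by congr (unshuffle_sum _ _ _ _); apply: bool_irrelevance.
Qed.

End LowArity.

(** * Three one-dimensional components *)

Section ThreeLines.

Variables (K : fieldType) (V : lmodType K) (G : grading V) (u v w : V).
Hypothesis (basisV : graded_basis G u v w).

(** The zero vector lies in every component, so nothing is known about i when
    y = 0. *)
Variant homogeneous_spec (i : int) (y : V) : Prop :=
  | Homogeneous0 of y = 0
  | HomogeneousU (k : K) of i = -1 & y = k *: u
  | HomogeneousV (k : K) of i = 0 & y = k *: v
  | HomogeneousW (k : K) of i = 1 & y = k *: w.

Lemma homogeneousP i y : y \in G i -> homogeneous_spec i y.
Proof.
have [[_ Gu] [_ Gv] [_ Gw] G0] := basisV => Gy.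
case i_supp: (i \in [:: -1; 0; 1]); last first.
  by apply/Homogeneous0/(G0 i) => //; rewrite i_supp.
rewrite !inE in i_supp; case/or3P: i_supp => /eqP eq_i; rewrite eq_i in Gy.
- by have [k] := (Gu y).1 Gy; exact: HomogeneousU.
- by have [k] := (Gv y).1 Gy; exact: HomogeneousV.
- by have [k] := (Gw y).1 Gy; exact: HomogeneousW.
Qed.

Lemma basis_degrees : [/\ u \in G (-1), v \in G 0 & w \in G 1].
Proof.
have [[_ Gu] [_ Gv] [_ Gw] _] := basisV.
by split; [apply: (Gu _).2 | apply: (Gv _).2 | apply: (Gw _).2];
  exists 1; rewrite scale1r.
Qed.

Lemma degree_outside i y : i \notin [:: -1; 0; 1] -> y \in G i -> y = 0.
Proof. by have [_ _ _ G0] := basisV; move=> ? ?; apply: (G0 i). Qed.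

Variable l : forall n : nat, {ffun 'I_n -> V} -> V.
Arguments l : clear implicits.
Hypotheses (charK0 : [pchar K] =i pred0).
Hypotheses (op1 : graded_operator G l 1) (op2 : graded_operator G l 2).
Variables (a b c : nat -> K).
Hypothesis (labc : given_by l u v w a b c).

Let Gu : u \in G (-1). Proof. by case: basis_degrees. Qed.
Let Gv : v \in G 0. Proof. by case: basis_degrees. Qed.
Let Gw : w \in G 1. Proof. by case: basis_degrees. Qed.

Lemma eq_opp0 (x : V) : x = - x -> x = 0.
Proof.
move/eqP; rewrite -subr_eq0 opprK -mulr2n -scaler_nat scaler_eq0.
by rewrite ((pcharf0P K).1 charK0) => /eqP.
Qed.

Lemma basis_neq0 : [/\ u != 0, v != 0 & w != 0].
Proof. by have [[? _] [? _] [? _] _] := basisV. Qed.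

Lemma diff_basis : [/\ diff l u = b 1 *: v, diff l v = c 1 *: w & diff l w = 0].
Proof.
have [_ lu lv _] := labc; split.
- rewrite -lu //; congr (l 1 _).
  by apply/ffunP=> i; rewrite !ffunE ord1.
- rewrite -lv //; congr (l 1 _).
  by apply/ffunP=> i; rewrite !ffunE ord1.
- by apply: degree_outside (diff_degree op1 Gw).
Qed.

Lemma bracket_basis :
  [/\ bracket l u v = a 2 *: u, bracket l u w = b 2 *: v
    & bracket l v w = c 2 *: w].
Proof.
have [luv lu lv _] := labc; split; last 2 first.
- exact: lu.
- exact: lv.
rewrite -luv //; congr (l 2 _).
by apply/ffunP=> i; rewrite !ffunE; case: i => [[|[|//]]].
Qed.

Lemma bracket_basis_rev :
  [/\ bracket l v u = - a 2 *: u, bracket l w u = b 2 *: v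
    & bracket l w v = - c 2 *: w].
Proof.
have [luv luw lvw] := bracket_basis; split.
- by rewrite (bracket_skew op2 Gu Gv) luv mul0r expr0z scaleN1r scaleNr.
- by rewrite (bracket_skew op2 Gu Gw) luw mul1r exprN1 invrN1 opprK scale1r.
- by rewrite (bracket_skew op2 Gv Gw) lvw mulr0 expr0z scaleN1r scaleNr.
Qed.

Lemma bracket_squares :
  [/\ bracket l u u = 0, bracket l v v = 0 & bracket l w w = 0].
Proof.
split.
- by apply: degree_outside (bracket_degree op2 Gu Gu).
- by apply: eq_opp0; rewrite {1}(bracket_skew op2 Gv Gv) mulr0 expr0z scaleN1r.
- by apply: degree_outside (bracket_degree op2 Gw Gw).
Qed.

(** Obtained from J_2 at (u, u), (u, w) and (u, v). *)
Lemma leibniz_constants : jacobiator_vanishes G l 2 ->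
  [/\ b 1 * a 2 = 0, b 1 * c 2 = c 1 * b 2 & a 2 * b 1 + c 1 * b 2 = 0].
Proof.
move=> J2.
have [u0 v0 w0] := basis_neq0.
have [du dv dw] := diff_basis.
have [luv luw lvw] := bracket_basis.
have [lvu lwu lwv] := bracket_basis_rev.
have [luu lvv lww] := bracket_squares.
have scale0 k (e : V) : e != 0 -> k *: e = 0 -> k = 0.
  by move=> /negPf e0 /eqP; rewrite scaler_eq0 e0 orbF => /eqP.
split.
- have := leibniz J2 Gu Gu.
  rewrite luu du (diff0 op1) (bracketZl op2) lvu mulrNN mulr1 expr1z scaleN1r opprK.
  move=> /esym /eqP; rewrite addr_eq0 => /eqP /eq_opp0.
  by rewrite scalerA mulrN => /(scale0 _ _ u0)/eqP; rewrite oppr_eq0 => /eqP.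
- have := leibniz J2 Gu Gw.
  rewrite luw du dw (diffZ op1) dv (bracketZl op2) lvw (bracket0l op2) scaler0 subr0.
  move=> /eqP; rewrite !scalerA -subr_eq0 -scalerBl => /eqP /(scale0 _ _ w0)/eqP.
  by rewrite subr_eq0 mulrC => /eqP ->.
- have := leibniz J2 Gu Gv.
  rewrite luv du dv (diffZ op1) du !(bracketZl op2) lvv lwu mul0r expr0z scale1r.
  rewrite scaler0 sub0r => /eqP.
  by rewrite -addr_eq0 !scalerA -scalerDl => /eqP /(scale0 _ _ v0).
Qed.

(** With b_2 = 0, V is the semidirect product of V_0 and an abelian ideal. A
    double bracket can only be nonzero when exactly two of its three arguments
    have degree 0; the two terms that survive for such arguments cancel, because
    V_0 is a line and acts on the third argument by commuting operators. Elements
    of degree 0 commute with everything without a Koszul sign. *)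
Lemma jacobi_b2_eq0 (le23 : (2 <= 3)%N) d x :
  b 2 = 0 -> homogeneous G d x -> unshuffle_sum l le23 d x = 0.
Proof.
move=> b2_0 Gx.
have [luv luw lvw] := bracket_basis.
have [lvu lwu lwv] := bracket_basis_rev.
have [luu lvv lww] := bracket_squares.
have bracket_0 i j y z : y \in G i -> z \in G j -> (i == 0) = (j == 0) ->
    bracket l y z = 0.
  { move=> /homogeneousP[-> _ | k -> -> | k -> -> | k -> ->];
    first by rewrite (bracket0l op2).
  all: move=> /homogeneousP[-> | k' -> -> | k' -> -> | k' -> ->] //;
    rewrite ?(bracket0r op2) ?(bracketZl op2) ?(bracketZr op2) //.
  all: by rewrite ?luw ?lwu ?luu ?lvv ?lww ?b2_0 ?scale0r !scaler0. }
have bracketNl y z : bracket l (- y) z = - bracket l y z.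
  by rewrite -[- y]scaleN1r (bracketZl op2) scaleN1r.
(* Both z and z' are multiples of v. *)
have bracket_comm y z z' : z \in G 0 -> z' \in G 0 ->
    bracket l (bracket l y z) z' = bracket l (bracket l y z') z.
  move=> Gz Gz'; have [_ [_ Lv] _ _] := basisV.
  have [[k ->] [k' ->]] := ((Lv z).1 Gz, (Lv z').1 Gz').
  by rewrite !(bracketZr op2) !(bracketZl op2) !scalerA mulrC.
have bracket_flip i y z : y \in G i -> z \in G 0 ->
    bracket l z y = - bracket l y z.
  by move=> Gy Gz; rewrite (bracket_skew op2 Gy Gz) mul0r expr0z scaleN1r.
have double_0 i j k y z t : y \in G i -> z \in G j -> t \in G k ->
    ~~ ((k == 0) && ((i == 0) != (j == 0))) ->
    bracket l (bracket l y z) t = 0.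
  move=> Gy Gz Gt; rewrite negb_and negbK => /orP[k0 | /eqP/(bracket_0 _ _ _ _ Gy Gz) ->];
    last by rewrite (bracket0l op2).
  case: (eqVneq (i == 0) (j == 0)) => [/(bracket_0 _ _ _ _ Gy Gz) -> | ij].
    by rewrite (bracket0l op2).
  (* Exactly one of i and j is zero, so the inner bracket and t both have
     nonzero degree. *)
  apply: (bracket_0 _ _ _ _ (bracket_degree op2 Gy Gz) Gt).
  rewrite (negPf k0); move: ij; case: (eqVneq i 0) => [-> | i0]; rewrite ?add0r.
    by case: (j == 0).
  by case: (eqVneq j 0) => [-> _ | //]; rewrite addr0; apply: negPf.
rewrite jacobi_sumE.
move: (Gx ord0) (Gx (lift ord0 ord0)) (Gx ord_max).
move: (x ord0) (x (lift _ _)) (x ord_max) => x0 x1 x2.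
move: (d ord0) (d (lift _ _)) (d ord_max) => d0 d1 d2 G0 G1 G2.
(* Unless exactly two of the three degrees are zero, each term vanishes. *)
case e0: (d0 == 0); case e1: (d1 == 0); case e2: (d2 == 0);
  try by rewrite (double_0 _ _ _ _ _ _ G0 G1 G2)
    ?(double_0 _ _ _ _ _ _ G0 G2 G1) ?(double_0 _ _ _ _ _ _ G1 G2 G0)
    ?e0 ?e1 ?e2 ?scaler0 ?subr0 ?addr0.
- rewrite (double_0 _ _ _ _ _ _ G0 G1 G2) ?e2 // sub0r.
  rewrite (eqP e0) in G0 *; rewrite (eqP e1) in G1 *.
  rewrite !mulr0 expr0z mulr1 !scale1r !(bracket_flip _ _ _ G2) // !bracketNl.
  by rewrite opprK (bracket_comm _ _ _ G0 G1) subrr.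
- rewrite (double_0 _ _ _ _ _ _ G0 G2 G1) ?e1 // scaler0 subr0.
  rewrite (eqP e0) in G0 *; rewrite (eqP e2) in G2 *.
  rewrite !mulr0 expr0z mulr1 !scale1r (bracket_flip _ _ _ G1) // bracketNl.
  by rewrite (bracket_comm _ _ _ G0 G2) addNr.
- rewrite (double_0 _ _ _ _ _ _ G1 G2 G0) ?e0 // scaler0 addr0.
  rewrite (eqP e1) in G1 *; rewrite (eqP e2) in G2 *.
  by rewrite mul0r expr0z scale1r (bracket_comm _ _ _ G1 G2) subrr.
Qed.

(** Every bracket is a multiple of v, and a_2 = c_2 = 0 makes v central. *)
Lemma double_bracket_eq0 i j k y z t : a 2 = 0 -> c 2 = 0 ->
  y \in G i -> z \in G j -> t \in G k -> bracket l (bracket l y z) t = 0.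
Proof.
move=> a2_0 c2_0.
have [luv luw lvw] := bracket_basis.
have [lvu lwu lwv] := bracket_basis_rev.
have [luu lvv lww] := bracket_squares.
have bracket_v t' k' : t' \in G k' -> bracket l v t' = 0.
  by move=> /homogeneousP[-> | m _ -> | m _ -> | m _ ->];
    rewrite ?(bracket0r op2) // (bracketZr op2) ?lvu ?lvv ?lvw ?a2_0 ?c2_0
      ?oppr0 ?scale0r ?scaler0.
suff vline : y \in G i -> z \in G j -> exists m, bracket l y z = m *: v.
  move=> Gy Gz Gt; have [m ->] := vline Gy Gz.
  by rewrite (bracketZl op2) (bracket_v _ _ Gt) scaler0.
move=> /homogeneousP[-> _ | m _ -> | m _ -> | m _ ->];
  first by exists 0; rewrite (bracket0l op2) scale0r.
all: move=> /homogeneousP[-> | m' _ -> | m' _ -> | m' _ ->];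
  first by exists 0; rewrite (bracket0r op2) scale0r.
all: rewrite (bracketZl op2) (bracketZr op2) ?luu ?luv ?luw ?lvu ?lvv ?lvw
       ?lwu ?lwv ?lww ?a2_0 ?c2_0 ?oppr0 ?scale0r.
all: try by exists 0; rewrite !scaler0 scale0r.
all: by rewrite !scalerA; eexists.
Qed.

End ThreeLines.

Theorem theorem4p10 (K : fieldType) (charK0 : [pchar K] =i pred0)
  (V : lmodType K) (G : grading V) (u v w : V)
  (basisV : graded_basis G u v w)
  (l : forall n : nat, {ffun 'I_n -> V} -> V) (a b c : nat -> K)
  (opl : forall n : nat, (1 <= n)%N -> graded_operator G l n)
  (labc : given_by l u v w a b c)
  (L3 : L_structure G l 3) :
  dg_Lie_algebra G l.
Proof.
have [_ J] := L3.
have [op1 op2 op3] : [/\ graded_operator G l 1, graded_operator G l 2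
  & graded_operator G l 3] by split; apply: opl.
split.
  split=> n /andP[n_gt0 le_n2]; first exact: opl.
  by apply: J; rewrite n_gt0 (leq_trans le_n2).
move=> d x Gx.
have [b1a2 b1c2 c1b2] := leibniz_constants basisV charK0 op1 op2 labc (J 2 isT).
have [b2_0 | b2_neq0] := eqVneq (b 2) 0.
  exact: (jacobi_b2_eq0 basisV charK0 op2 labc).
have c1_0 : c 1 = 0.
  move/eqP: c1b2; rewrite mulrC b1a2 add0r mulf_eq0 (negPf b2_neq0) orbF.
  by move/eqP.
have [b1_0 | b1_neq0] := eqVneq (b 1) 0; last first.
  have [a2_0 c2_0] : a 2 = 0 /\ c 2 = 0.
    move/eqP: b1c2; move/eqP: b1a2; rewrite c1_0 mul0r !mulf_eq0 (negPf b1_neq0).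
    by move=> /eqP -> /eqP ->.
  have double_0 := double_bracket_eq0 basisV charK0 op2 labc a2_0 c2_0.
  rewrite jacobi_sumE !(double_0 _ _ _ _ _ _ (Gx _) (Gx _) (Gx _)).
  by rewrite !scaler0 subr0 addr0.
rewrite -(jacobi_of_diff0 _ op3 _ Gx); first exact: (J 3 isT).
have [du dv dw] := diff_basis basisV op1 labc.
move=> i y /(homogeneousP basisV)[-> | k _ -> | k _ -> | k _ ->];
  rewrite ?(diff0 op1) // (diffZ op1) ?du ?dv ?dw ?b1_0 ?c1_0 ?scale0r.
all: exact: scaler0.
Qed.
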